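(* Let $T\ge 1$ be an integer, $0<c_1\le c_2$ real numbers, $\{R_k\}_{k\in N_T}$ a sequence of real symmetric positive definite $n\times n$ matrices, and $\{A_k\}_{k\in N_{T-1}},\{C_k\}_{k\in N_{T-1}}$ real $n\times n$ matrices. Suppose there exists a sequence of symmetric positive definite $n\times n$ matrices $\{P_k\}_{k\in N_T}$ such that $$c_1\overline{\lambda}-c_2\underline{\lambda}<0,$$ $$A_j'R_{j+1}^{\frac12}P_{j+1}R_{j+1}^{\frac12}A_j+C_j'R_{j+1}^{\frac12}P_{j+1}R_{j+1}^{\frac12}C_j-R_j^{\frac12}P_jR_j^{\frac12}<0,\quad j\in N_{T-1},$$ where $\underline{\lambda}=\min_{k\in N_T}\lambda_{\min}(P_k)$ and $\overline{\lambda}=\lambda_{\max}(P_0)$. Then the system $x_{k+1}=A_kx_k+C_kx_kw_k$, $x_0\in\mathbb{R}^n$, $k\in N_{T-1}$, is finite-time stable with respect to $(c_1,c_2,T,\{R_k\}_{k\in N_T})$.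
   Context: $N_T:=\{0,1,\dots,T\}$. $M'$ is the transpose; $M<0$ for a symmetric matrix means negative definite; $R^{1/2}$ is the symmetric positive definite square root; $\lambda_{\min},\lambda_{\max}$ are the minimum and maximum eigenvalues of a real symmetric matrix. $\|x\|_R^2:=x'Rx$. $\{w_k\}_{k\in N_{T-1}}$ is a sequence of independent real random variables on a complete probability space with $E[w_k]=0$ and $E[w_kw_j]=\delta_{kj}$ (Kronecker delta); $x_0$ is deterministic. Finite-time stability: the system is finite-time stable with respect to $(c_1,c_2,T,\{R_k\}_{k\in N_T})$ if for every deterministic $x_0\in\mathbb{R}^n$, $\|x_0\|_{R_0}^2\le c_1$ implies $E\|x_k\|_{R_k}^2<c_2$ for all $k\in N_T$. *)

(* Defs.v *)
From HB Require Import structures.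
From mathcomp Require Export all_boot all_order all_algebra.
From mathcomp Require Export finmap.
From mathcomp Require Export all_classical all_reals all_analysis.

Set Implicit Arguments.
Unset Strict Implicit.
Unset Printing Implicit Defensive.

Export Order.TTheory GRing.Theory Num.Theory.
Export numFieldNormedType.Exports.

Local Open Scope classical_set_scope.
Local Open Scope ring_scope.

Definition qform (R : realType) (n : nat) (M : 'M[R]_n) (x : 'cV[R]_n) : R :=
  (x^T *m M *m x) 0 0.

Definition posdefmx (R : realType) (n : nat) (M : 'M[R]_n) : Prop :=
  M \is symmetricmx /\ forall x : 'cV[R]_n, x != 0 -> 0 < qform M x.

Definition negdefmx (R : realType) (n : nat) (M : 'M[R]_n) : Prop :=
  M \is symmetricmx /\ forall x : 'cV[R]_n, x != 0 -> qform M x < 0.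

(* For positive definite [M] exactly one matrix qualifies; the default value 0
   is only returned when there is none. *)
Definition sqrtmx (R : realType) (n : nat) (M : 'M[R]_n) : 'M[R]_n :=
  xget 0 [set S : 'M[R]_n | posdefmx S /\ S *m S = M].

(* The set of eigenvalues is finite, and nonempty for a real symmetric matrix
   of size n > 0, so that [inf] and [sup] are then a minimum and a maximum. *)
Definition lambda_min (R : realType) (n : nat) (M : 'M[R]_n) : R :=
  inf [set a : R | eigenvalue M a].

Definition lambda_max (R : realType) (n : nat) (M : 'M[R]_n) : R :=
  sup [set a : R | eigenvalue M a].

(* Mutual independence of the family [X i], i in [D]. *)
Definition independent_RVs (d : measure_display) (Omega : measurableType d)
    (R : realType) (Pr : probability Omega R) (I : choiceType) (D : set I)
    (X : I -> {RV Pr >-> R}) : Prop :=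
  forall (J : {fset I}) (B : I -> set R),
    [set` J] `<=` D ->
    (forall i, i \in J -> measurable (B i)) ->
    Pr (\bigcap_(i in [set` J]) (X i @^-1` B i)) =
      (\prod_(i <- J) Pr (X i @^-1` B i))%E.

Fixpoint state (Omega : Type) (R : realType) (n : nat) (A C : nat -> 'M[R]_n)
    (w : nat -> Omega -> R) (x0 : 'cV[R]_n) (k : nat) (omega : Omega)
    : 'cV[R]_n :=
  match k with
  | 0%N => x0
  | k'.+1 => let xk := state A C w x0 k' omega in
             A k' *m xk + w k' omega *: (C k' *m xk)
  end.

(* [sys x0 k omega] is the state at time [k] of the system started at the
   deterministic state [x0]. *)
Definition finite_time_stable (d : measure_display) (Omega : measurableType d)
    (R : realType) (Pr : probability Omega R) (n : nat)
    (sys : 'cV[R]_n -> nat -> Omega -> 'cV[R]_n)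
    (c1 c2 : R) (T : nat) (Rk : nat -> 'M[R]_n) : Prop :=
  forall x0 : 'cV[R]_n, qform (Rk 0%N) x0 <= c1 ->
    forall k : nat, (k <= T)%N ->
      ('E_Pr[fun omega => qform (Rk k) (sys x0 k omega)] < c2%:E)%E.

(* Main.v *)
From HB Require Import structures.
From mathcomp Require Import ring lra measurable_realfun complex.
Require Import Defs.

(** The quadratic forms V_j(y) = y' R_j^(1/2) P_j R_j^(1/2) y form a Lyapunov
    function in mean.  Since w_j has mean 0 and variance 1 and is independent
    of x_j, expanding the square gives, for every matrix N,
      E[x_{j+1}' N x_{j+1}] = E[x_j' (A_j' N A_j + C_j' N C_j) x_j],
    so the matrix inequalities say that E[V_j(x_j)] does not increase, and
    E[V_k(x_k)] <= V_0(x_0) (expectation_qform_nonincreasing).  On the other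
    hand V_k(y) lies between lambda_min(P_k) y' R_k y and
    lambda_max(P_k) y' R_k y, because (R_k^(1/2) y)' (R_k^(1/2) y) = y' R_k y.
    Chaining, lo * E[x_k' R_k x_k] <= lambda_max(P_0) c1 < lo * c2 with lo the
    smallest of the lambda_min(P_k), and lo > 0.

    Linear algebra.  Over the complex numbers a real symmetric M is unitarily
    diagonalizable with real spectrum; similarity of real matrices descends to
    the reals, so M = P^-1 diag(d) P with P and d real
    (symmetric_diagonalizable).  P need not be orthogonal, yet all the
    matrices P^-1 diag(g(d)) P are again symmetric (spectral_fun_sym).  With
    g = sqrt this yields square roots; with g(t) = sqrt(t - a) it exhibits
    M - a as a square as soon as a bounds the spectrum from below, whence the
    Rayleigh bounds (qform_lambda_bounds).

    Probability.  The cylinders over w_0, ..., w_{k-1} form a pi-system whose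
    elements are independent of w_k by hypothesis, and Dynkin's theorem extends
    this to the sigma-algebra of the past (past_independent).  As x_k is
    measurable for the past, independence turns joint laws into product laws,
    and Fubini's theorem factors the expectations
    (expectation_mul_independent).  Integrability is an induction: the family
    of all quadratic forms in x_k is stable under one step of the recursion, so
    it suffices to carry the statement for every matrix N at once. *)

Set Implicit Arguments.
Unset Strict Implicit.
Unset Printing Implicit Defensive.

Local Open Scope classical_set_scope.
Local Open Scope ring_scope.

(** * Spectral theory of real symmetric matrices *)

Section Spectral.
Variable R : realType.

Lemma symmetricmxE n (M : 'M[R]_n) : (M \is symmetricmx) = (M^T == M).
Proof. by rewrite qualifE /= expr0 scale1r map_mx_id// eq_sym. Qed.

(** The complex spectral theorem gives a unitary conjugation of [M] to a real
    diagonal matrix; two real matrices that are similar over the complex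
    numbers are similar over the reals. *)
Lemma symmetric_diagonalizable n (M : 'M[R]_n) : M \is symmetricmx ->
  exists (P : 'M[R]_n) (d : 'rV[R]_n),
    P \in unitmx /\ M = invmx P *m diag_mx d *m P.
Proof.
move=> Msym; pose toC : R -> R[i] := real_complex R.
have realE p q (N : 'M[R]_(p, q)) : map_mx toC N \is a mxOver Num.real.
  by apply/mxOverP => i j; rewrite mxE; apply/complex_realP; eexists.
have liftE p q (N : 'M[R[i]]_(p, q)) : N \is a mxOver Num.real ->
    exists N0 : 'M[R]_(p, q), N = map_mx toC N0.
  move=> /mxOverP Nreal; exists (map_mx (@complex.Re R) N).
  by apply/matrixP => i j; rewrite !mxE /toC RRe_real.
have Mherm : map_mx toC M \is hermsymmx.
  apply: realsym_hermsym => //; rewrite qualifE /= expr0 scale1r map_mx_id//.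
  by move: Msym; rewrite symmetricmxE map_trmx => /eqP ->.
have /hermitian_normalmx /orthomx_spectralP ME := Mherm.
have [d dE] := liftE _ _ _ (hermitian_spectral_diag_real Mherm).
have : similar_in unitmx (map_mx toC M) (map_mx toC (diag_mx d)).
  exists (spectralmx (map_mx toC M)); first exact: spectral_unit.
  apply/similarP; first exact: spectral_unit.
  by rewrite map_diag_mx -dE {2}ME !mulmxA mulmxV ?spectral_unit// mul1mx.
case/real_similar => // Q; rewrite inE => /andP[/liftE[P ->]].
rewrite map_unitmx => Pu /similarP; rewrite map_unitmx => /(_ Pu).
rewrite -!map_mxM => /map_mx_inj PM.
exists P, d; split=> //.
by rewrite -mulmxA -PM mulmxA mulVmx// mul1mx.
Qed.

Lemma qformM n (A B C : 'M[R]_n) x :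
  qform (A^T *m B *m C) x = ((A *m x)^T *m B *m (C *m x)) 0 0.
Proof. by rewrite /qform trmx_mul !mulmxA. Qed.

Lemma qform_congr n (A B : 'M[R]_n) x : qform (A^T *m B *m A) x = qform B (A *m x).
Proof. by rewrite qformM /qform. Qed.

Lemma qformD n (A B : 'M[R]_n) x : qform (A + B) x = qform A x + qform B x.
Proof. by rewrite /qform mulmxDr mulmxDl mxE. Qed.

Lemma qformN n (A : 'M[R]_n) x : qform (- A) x = - qform A x.
Proof. by rewrite /qform mulmxN mulNmx mxE. Qed.

Lemma qformZ n a (A : 'M[R]_n) x : qform (a *: A) x = a * qform A x.
Proof. by rewrite /qform -scalemxAr -scalemxAl [LHS]mxE. Qed.

Lemma qform_scalar n a (x : 'cV[R]_n) : qform a%:M x = a * qform 1%:M x.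
Proof. by rewrite -[in LHS]scalemx1 qformZ. Qed.

Lemma qform1_ge0 n (x : 'cV[R]_n) : 0 <= qform 1%:M x.
Proof.
by rewrite /qform mulmx1 mxE sumr_ge0// => i _; rewrite mxE -expr2 sqr_ge0.
Qed.

Lemma qform1_gt0 n (x : 'cV[R]_n) : x != 0 -> 0 < qform 1%:M x.
Proof.
apply: contra_neqT; rewrite -real_leNgt ?num_real// /qform mulmx1 mxE => x0.
have F0 i : 0 <= x^T 0 i * x i 0 by rewrite mxE -expr2 sqr_ge0.
have /eqP := le_anti (introT andP (conj x0 (sumr_ge0 _ (fun i _ => F0 i)))).
rewrite psumr_eq0// => /allP x00; apply/colP => i.
by have := x00 i (mem_index_enum _); rewrite !mxE -expr2 sqrf_eq0 => /eqP.
Qed.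

Lemma qform_sqr n (Q : 'M[R]_n) x : Q^T = Q ->
  qform (Q *m Q) x = qform 1%:M (Q *m x).
Proof. by move=> Qs; rewrite -{1}Qs -[Q^T]mulmx1 qform_congr. Qed.

(** This is g(M) for the matrix M = P^-1 diag(d) P. *)
Definition spectral_fun n (P : 'M[R]_n) (d : 'rV[R]_n) (g : R -> R) : 'M[R]_n :=
  invmx P *m diag_mx (map_mx g d) *m P.

Section FunctionalCalculus.
Variables (n : nat) (P : 'M[R]_n) (d : 'rV[R]_n).
Hypothesis Pu : P \in unitmx.
Local Notation fcalc := (spectral_fun P d).
Local Notation M := (fcalc id).

Lemma spectral_funM g h : fcalc (fun t => g t * h t) = fcalc g *m fcalc h.
Proof.
rewrite /spectral_fun !mulmxA mulmxK// -(mulmxA _ (diag_mx _) (diag_mx _)) mulmx_diag.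
congr (_ *m diag_mx _ *m _).
by apply/rowP => i; rewrite !mxE.
Qed.

Lemma sqr_spectral_fun g : (forall i, 0 <= g (d 0 i)) ->
  fcalc (fun t => Num.sqrt (g t)) *m fcalc (fun t => Num.sqrt (g t)) = fcalc g.
Proof.
move=> g0; rewrite -spectral_funM /spectral_fun; congr (_ *m diag_mx _ *m _).
apply/rowP => i; by rewrite !mxE -expr2 sqr_sqrtr.
Qed.

Lemma spectral_funB g h : fcalc (fun t => g t - h t) = fcalc g - fcalc h.
Proof.
rewrite /spectral_fun -mulmxBl -mulmxBr -raddfB /=; congr (_ *m diag_mx _ *m _).
by apply/rowP => i; rewrite !mxE.
Qed.

Lemma spectral_fun_cst a : fcalc (cst a) = a%:M.
Proof.
rewrite /spectral_fun (_ : map_mx _ _ = const_mx a); last by apply/rowP => i; rewrite !mxE.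
by rewrite diag_const_mx mul_mx_scalar -scalemxAl mulVmx// scalemx1.
Qed.

Lemma spectral_fun_scalarB a : fcalc (fun t => t - a) = M - a%:M.
Proof. by rewrite (spectral_funB id (cst a)) spectral_fun_cst. Qed.

Lemma spectral_fun_scalarBr a : fcalc (fun t => a - t) = a%:M - M.
Proof. by rewrite (spectral_funB (cst a) id) spectral_fun_cst. Qed.

Lemma eigenvalue_spectral_fun a : reflect (exists i, a = d 0 i) (eigenvalue M a).
Proof.
have ME : P *m M = diag_mx d *m P.
  by rewrite /spectral_fun map_mx_id// !mulmxA mulmxV// mul1mx.
apply: (iffP eigenvalueP) => [[v vM v0]|[i ->]].
  have [i vi] : exists i, (v *m invmx P) 0 i != 0.
    apply/existsP; apply: contraNT v0; rewrite negb_exists => /forallP v0.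
    rewrite -[v](mulmxKV Pu); apply/eqP; rewrite (_ : _ *m invmx P = 0) ?mul0mx//.
    by apply/rowP => i; have := v0 i; rewrite negbK => /eqP ->; rewrite mxE.
  exists i; have : v *m invmx P *m (P *m M) *m invmx P = a *: (v *m invmx P).
    by rewrite mulmxA mulmxKV// vM scalemxAl.
  rewrite ME !mulmxA mulmxK// mul_mx_diag => /rowP /(_ i); rewrite !mxE => /eqP.
  rewrite mulrC -subr_eq0 -mulrBl mulf_eq0 subr_eq0.
  by move: vi; rewrite mxE => /negPf ->; rewrite orbF => /eqP ->.
exists (row i P); first by rewrite -row_mul ME row_mul row_diag_mx -scalemxAl -rowE.
apply: contraTneq Pu => rowP0; rewrite -row_free_unit -kermx_eq0.
apply/negP => /eqP ker0; have : (delta_mx 0 i : 'rV[R]_n) *m P = 0 by rewrite -rowE.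
move/sub_kermxP; rewrite ker0 submx0 => /eqP /rowP /(_ i); rewrite !mxE !eqxx.
by move/eqP; rewrite oner_eq0.
Qed.

Hypothesis Msym : M^T = M.

(** The symmetry of [M] says that N = P P' commutes with diag(d), that is,
    N_ij = 0 unless d_i = d_j; then N commutes with diag(g(d)) for every [g]. *)
Lemma spectral_fun_sym g : (fcalc g)^T = fcalc g.
Proof.
have PTu : P^T \in unitmx by rewrite unitmx_tr.
pose N := P *m P^T.
have comm_iff h : (fcalc h)^T = fcalc h <->
    N *m diag_mx (map_mx h d) = diag_mx (map_mx h d) *m N.
  rewrite /spectral_fun !trmx_mul tr_diag_mx trmx_inv /N; split=> [E|E].
    move/(congr1 (fun X => P *m X *m P^T)): E.
    by rewrite !mulmxA mulmxKV// mulmxV// mul1mx.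
  move/(congr1 (fun X => invmx P *m X *m invmx P^T)): E.
  by rewrite !mulmxA mulmxK// mulVmx// mul1mx.
apply/comm_iff; have /comm_iff/matrixP comm : (fcalc id)^T = fcalc id := Msym.
clear comm_iff; clearbody N; apply/matrixP => i j; move: (comm i j).
rewrite !(mul_diag_mx, mul_mx_diag) !mxE /=.
have [->|dij] := eqVneq (d 0 i) (d 0 j); first by move=> _; rewrite mulrC.
move=> /eqP; rewrite [eqbRHS]mulrC -subr_eq0 -mulrBr mulf_eq0 subr_eq0.
by rewrite (eq_sym (d 0 j)) (negPf dij) orbF => /eqP ->; rewrite mul0r mulr0.
Qed.

(** g(M) is the square of the symmetric matrix sqrt(g)(M). *)
Lemma qform_spectral_fun_ge0 g x : (forall i, 0 <= g (d 0 i)) -> 0 <= qform (fcalc g) x.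
Proof.
by move=> g0; rewrite -sqr_spectral_fun// qform_sqr ?qform1_ge0// spectral_fun_sym.
Qed.

End FunctionalCalculus.

Lemma symmetric_spectral n (M : 'M[R]_n) : M \is symmetricmx ->
  exists (P : 'M[R]_n) (d : 'rV[R]_n),
    [/\ P \in unitmx, M = spectral_fun P d id
      & forall a, eigenvalue M a <-> exists i, a = d 0 i].
Proof.
move=> /symmetric_diagonalizable[P [d [Pu ME]]].
have {}ME : M = spectral_fun P d id by rewrite /spectral_fun map_mx_id.
exists P, d; split=> // a; rewrite ME.
by split => /(eigenvalue_spectral_fun d Pu).
Qed.

Lemma posdef_eigenvalue_gt0 n (M : 'M[R]_n) a :
  posdefmx M -> eigenvalue M a -> 0 < a.
Proof.
move=> [_ Mpos] /eigenvalueP [v vM v0].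
have vT0 : v^T != 0 by rewrite trmx_eq0.
have := Mpos _ vT0; rewrite /qform trmxK vM -scalemxAl mxE.
rewrite pmulr_lgt0//; have := qform1_gt0 vT0.
by rewrite /qform trmxK mulmx1.
Qed.

(** With a = lambda_min(M), the function t - a is nonnegative on the spectrum
    of [M], so M - a is positive semidefinite; likewise for lambda_max(M). *)
Lemma qform_lambda_bounds n (M : 'M[R]_n) x : M \is symmetricmx ->
  lambda_min M * qform 1%:M x <= qform M x <= lambda_max M * qform 1%:M x.
Proof.
move=> Ms; have [P [d [Pu ME spec]]] := symmetric_spectral Ms.
have MT : (spectral_fun P d id)^T = spectral_fun P d id.
  by rewrite -ME; apply/eqP; rewrite -symmetricmxE.
(* The spectrum is finite; any crude bound makes inf and sup meaningful. *)
have dub : ubound [set a | eigenvalue M a] (\sum_i `|d 0 i|).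
  move=> _ /spec[i ->]; rewrite (bigD1 i)//= ler_wpDr ?sumr_ge0//.
  exact: ler_norm.
have dlb : lbound [set a | eigenvalue M a] (- \sum_i `|d 0 i|).
  move=> _ /spec[i ->]; rewrite (bigD1 i)//= lerNl ler_wpDr ?sumr_ge0//.
  by rewrite -normrN ler_norm.
have sp i : [set a | eigenvalue M a] (d 0 i) by apply/spec; exists i.
apply/andP; split; rewrite -subr_ge0 -qform_scalar -qformN -qformD.
  rewrite {1}ME -spectral_fun_scalarB//.
  apply: qform_spectral_fun_ge0 => // i.
  by rewrite subr_ge0 ge_inf//; exists (- \sum_i `|d 0 i|).
rewrite {2}ME -spectral_fun_scalarBr//.
apply: qform_spectral_fun_ge0 => // i.
by rewrite subr_ge0 ub_le_sup//; exists (\sum_i `|d 0 i|).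
Qed.

Lemma lambda_min_gt0 n (M : 'M[R]_n) : (0 < n)%N -> posdefmx M ->
  0 < lambda_min M.
Proof.
move=> n0 Mp; have [P [d [_ _ spec]]] := symmetric_spectral Mp.1.
have [|i _ imin] := @arg_minP _ _ _ (Ordinal n0) predT (fun i => d 0 i); first by [].
apply: (@lt_le_trans _ _ (d 0 i)).
  by apply: (posdef_eigenvalue_gt0 Mp); apply/spec; exists i.
apply: lb_le_inf; first by exists (d 0 i); apply/spec; exists i.
by move=> _ /spec[j ->]; exact: imin.
Qed.

Lemma lambda_max_ge0 n (M : 'M[R]_n) : posdefmx M -> 0 <= lambda_max M.
Proof.
move=> Mp; rewrite /lambda_max.
have [hs|/sup_out ->//] := pselect (has_sup [set a | eigenvalue M a]).
have [[a Ma] ub] := hs.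
by apply: le_trans (ub_le_sup ub Ma); apply/ltW/(posdef_eigenvalue_gt0 Mp).
Qed.

(** S = sqrt(M) is itself the square of the symmetric matrix Q = M^(1/4), so
    y' S y = |Q y|^2, and Q y = 0 forces M y = Q^4 y = 0. *)
Lemma sqrtmxP n (M : 'M[R]_n) : posdefmx M ->
  posdefmx (sqrtmx M) /\ sqrtmx M *m sqrtmx M = M.
Proof.
move=> Mp; apply: (xgetPex 0 (P := [set S : 'M[R]_n | posdefmx S /\ S *m S = M])).
have [P [d [Pu ME spec]]] := symmetric_spectral Mp.1.
have d0 i : 0 <= d 0 i.
  by apply: ltW; apply: (posdef_eigenvalue_gt0 Mp); apply/spec; exists i.
have FT g : (spectral_fun P d g)^T = spectral_fun P d g.
  apply: spectral_fun_sym => //; rewrite -ME; apply/eqP.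
  by rewrite -symmetricmxE; exact: Mp.1.
pose S := spectral_fun P d Num.sqrt.
pose Q := spectral_fun P d (Num.sqrt \o Num.sqrt).
have SS : S *m S = M by rewrite ME; exact: (@sqr_spectral_fun _ P d Pu id d0).
have QQ : Q *m Q = S.
  by apply: (@sqr_spectral_fun _ P d Pu Num.sqrt) => i; exact: sqrtr_ge0.
have [ST QT] : S^T = S /\ Q^T = Q by split; exact: FT.
clearbody S Q; exists S; split=> //; split=> [|x x0].
  by rewrite symmetricmxE ST.
rewrite -QQ qform_sqr//; apply: qform1_gt0; apply/eqP => Qx0.
by have := Mp.2 x x0; rewrite /qform -SS -QQ -!mulmxA Qx0 !mulmx0 mxE ltxx.
Qed.

Lemma negdefmx_le0 n (M : 'M[R]_n) y : negdefmx M -> qform M y <= 0.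
Proof.
move=> [_ Mneg]; have [->|/Mneg/ltW//] := eqVneq y 0.
by rewrite /qform mulmx0 mxE.
Qed.

Lemma qform_weight n (Q P : 'M[R]_n) y : posdefmx Q ->
  qform (sqrtmx Q *m P *m sqrtmx Q) y = qform P (sqrtmx Q *m y) /\
  qform Q y = qform 1%:M (sqrtmx Q *m y).
Proof.
move=> /sqrtmxP[[Ss _] SS].
have ST : (sqrtmx Q)^T = sqrtmx Q by apply/eqP; rewrite -symmetricmxE.
by split; [rewrite -{1}ST qform_congr|rewrite -{1}SS qform_sqr].
Qed.

End Spectral.

(** * Independence and the sigma-algebra of the past *)

Section Indep.
Context d (Omega : measurableType d) (R : realType) (Pr : probability Omega R).

Definition independent2 (X Y : Omega -> R) : Prop := forall A B : set R,
  measurable A -> measurable B ->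
  Pr (X @^-1` A `&` Y @^-1` B) = (Pr (X @^-1` A) * Pr (Y @^-1` B))%E.

(** Independence says that the law of the pair [(X, Y)] agrees with the product
    of the laws on rectangles, and rectangles determine the product measure. *)
Lemma integral_joint_law (X Y : {RV Pr >-> R}) (f : R * R -> \bar R) :
  independent2 X Y -> measurable_fun setT f ->
  Pr.-integrable setT (fun w => f (X w, Y w)) \/ (forall z, 0 <= f z)%E ->
  (\int[distribution Pr X \x distribution Pr Y]_z f z =
   \int[Pr]_w f (X w, Y w))%E.
Proof.
move=> XY mf fint.
have mZ : measurable_fun setT (fun w => (X w, Y w)) by exact: measurable_fun_pair.
pose Zmix := isMeasurableFun.Build _ _ _ _ _ mZ.
pose Z : {mfun Omega >-> (R * R)%type} := HB.pack (fun w => (X w, Y w)) Zmix.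
rewrite (@eq_measure_integral _ _ _ _ (distribution Pr Z)).
  by case: fint => fint; [exact: (@integral_distribution _ _ _ _ _ Pr Z)
    |exact: (@ge0_integral_distribution _ _ _ _ _ Pr Z)].
move=> A mA _; apply: product_measure_unique mA => {}A B mA mB.
exact: XY.
Qed.

(** Tonelli for the absolute values gives integrability, then Fubini factors
    the integral of the product. *)
Lemma expectation_mul_independent_RV (X Y : {RV Pr >-> R}) : independent2 X Y ->
  Pr.-integrable setT (EFin \o X) -> Pr.-integrable setT (EFin \o Y) ->
  Pr.-integrable setT (EFin \o (fun w => X w * Y w)) /\
  ('E_Pr[(fun w => X w * Y w)%R] = 'E_Pr[X] * 'E_Pr[Y])%E.
Proof.
move=> XY iX iY.
have mf : measurable_fun [set: R * R] (fun z : R * R => (z.1 * z.2)%:E).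
  by apply/measurable_EFinP; exact: measurable_funM.
have mabs : measurable_fun [set: R] (fun y : R => `|y|%:E).
  by apply/measurable_EFinP; exact: (@normr_measurable R setT).
have [_ lX] := integrableP _ _ _ iX; have [_ lY] := integrableP _ _ _ iY.
have absE (V : {RV Pr >-> R}) :
    (\int[distribution Pr V]_y `|y|%:E = \int[Pr]_w `|(V w)%:E|)%E.
  by rewrite ge0_integral_distribution.
have iprod : (distribution Pr X \x distribution Pr Y)%E.-integrable setT
    (fun z : R * R => (z.1 * z.2)%:E).
  apply/integrable12ltyP => //=.
  under eq_integral => x _.
    under eq_integral do rewrite normrM EFinM.
    rewrite ge0_integralZl_EFin//; over.
  rewrite ge0_integralZr//; last first.
    by rewrite integral_ge0// => y _; rewrite lee_fin.
  by rewrite !absE lte_mul_pinfty// ?integral_ge0// ge0_fin_numE// integral_ge0.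
have iXY : Pr.-integrable setT (EFin \o (fun w => X w * Y w)).
  apply/integrableP; split.
    by apply/measurable_EFinP; exact: measurable_funM.
  have [_] := integrableP _ _ _ iprod.
  rewrite (@integral_joint_law X Y (fun z => `|(z.1 * z.2)%:E|%E))//.
    exact: measurableT_comp.
  by right=> z; exact: abse_ge0.
split=> //; rewrite unlock.
rewrite -(@integral_joint_law X Y (fun z => (z.1 * z.2)%:E))//; last by left.
rewrite -integral12_prod_meas1//= /fubini_F.
have idE (V : {RV Pr >-> R}) : Pr.-integrable setT (EFin \o V) ->
    (distribution Pr V).-integrable setT EFin /\
    (\int[distribution Pr V]_y y%:E = \int[Pr]_w (V w)%:E)%E.
  by move=> iV; split; [exact: integrable_pushforward|exact: integral_distribution].
have [iX' <-] := idE X iX; have [iY' <-] := idE Y iY.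
under eq_integral => x _.
  under eq_integral do rewrite EFinM.
  rewrite integralZl//; over.
rewrite -[in RHS](fineK (integrable_fin_num measurableT iY')) -integralZr//.
by apply: eq_integral => x _; rewrite fineK ?integrable_fin_num.
Qed.

Lemma expectation_mul_independent (X Y : Omega -> R) : independent2 X Y ->
  Pr.-integrable setT (EFin \o X) -> Pr.-integrable setT (EFin \o Y) ->
  Pr.-integrable setT (EFin \o (fun w => X w * Y w)) /\
  ('E_Pr[(fun w => X w * Y w)%R] = 'E_Pr[X] * 'E_Pr[Y])%E.
Proof.
move=> XY iX iY.
have mX : measurable_fun setT X by apply/measurable_EFinP; exact: measurable_int iX.
have mY : measurable_fun setT Y by apply/measurable_EFinP; exact: measurable_int iY.
pose Xmix := isMeasurableFun.Build _ _ _ _ _ mX.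
pose Ymix := isMeasurableFun.Build _ _ _ _ _ mY.
pose X' : {mfun Omega >-> R} := HB.pack X Xmix.
pose Y' : {mfun Omega >-> R} := HB.pack Y Ymix.
exact: (@expectation_mul_independent_RV X' Y').
Qed.

Section Past.
Variables (T : nat) (w : nat -> {RV Pr >-> R}).
Hypothesis w_indep : independent_RVs [set k : nat | (k < T)%N] w.

Definition past_cylinder (k : nat) : set (set Omega) :=
  [set E | exists B : nat -> set R, (forall i, measurable (B i)) /\
     E = \bigcap_(i in [set i | (i < k)%N]) (w i @^-1` B i)].

Lemma past_cylinderI k : setI_closed (past_cylinder k).
Proof.
move=> _ _ [B [mB ->]] [B' [mB' ->]].
exists (fun i => B i `&` B' i); split; first by move=> i; exact: measurableI.
by rewrite -bigcapI.
Qed.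

(** The product rule for the finite index set {0, ..., k} and the one for
    {0, ..., k-1} differ exactly by the factor of index [k]. *)
Lemma past_cylinder_independent k E B : (k < T)%N -> past_cylinder k E ->
  measurable B -> Pr (E `&` w k @^-1` B) = (Pr E * Pr (w k @^-1` B))%E.
Proof.
move=> kT [C [mC ->]] mB; pose J := [fset i in iota 0 k]%fset.
have JE : [set i | (i < k)%N] = [set` J].
  by apply/seteqP; split=> i; rewrite /= !inE mem_iota.
pose C' i := if i == k then B else C i.
have C'E i : (i < k)%N -> C' i = C i by rewrite /C' => /ltn_eqF ->.
have mC' i : measurable (C' i) by rewrite /C'; case: ifP.
have kJ : k \notin J by rewrite !inE mem_iota /= ltnn.
have CE : \bigcap_(i in [set i | (i < k)%N]) (w i @^-1` C i) =
    \bigcap_(i in [set` J]) (w i @^-1` C' i).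
  by rewrite -JE; apply: eq_bigcapr => i ik; rewrite C'E.
have JT : [set` J] `<=` [set k | (k < T)%N].
  by rewrite -JE => i /= ik; apply: ltn_trans kT.
rewrite CE setIC (w_indep JT)//.
have kC : w k @^-1` B = w k @^-1` C' k by rewrite /C' eqxx.
rewrite kC -(bigcap_fsetU1 (fun i => w i @^-1` C' i)) w_indep//.
  by rewrite big_fsetU1//= muleC.
by move=> i /=; rewrite !inE => /orP[/eqP ->//|ik]; apply: JT; rewrite /= !inE.
Qed.

(** The events independent of a fixed event {w_k in B} form a lambda-system; it
    contains the pi-system of cylinders. *)
Lemma past_independent k E B : (k < T)%N -> <<s past_cylinder k >> E ->
  measurable B ->
  measurable E /\ Pr (E `&` w k @^-1` B) = (Pr E * Pr (w k @^-1` B))%E.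
Proof.
move=> kT sE mB; have mwB : measurable (w k @^-1` B) by exact: measurable_funPTI.
pose H := [set E | measurable E /\
  Pr (E `&` w k @^-1` B) = (Pr E * Pr (w k @^-1` B))%E].
suff : <<s past_cylinder k >> `<=` H by move/(_ _ sE).
have fin A : measurable A -> Pr A \is a fin_num by exact: fin_num_measure.
apply: lambda_system_subset; [exact: past_cylinderI| |move=> A cA|by []]; last first.
  split; last exact: past_cylinder_independent.
  by case: cA => C [mC ->]; apply: bigcap_measurableType => i _; exact: measurable_funPTI.
split=> //.
- by split=> //; rewrite setTI probability_setT mul1e.
- move=> A A' A'A [mA AE] [mA' A'E]; split; first exact: measurableD.
  set D := w k @^-1` B in mwB AE A'E *.
  have -> : (A `\` A') `&` D = (A `&` D) `\` (A' `&` D).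
    by rewrite setIDAC -setIDA; apply/seteqP; split=> x /=; tauto.
  have lty X : measurable X -> (Pr X < +oo)%E by move=> mX; rewrite ltey_eq fin.
  have mI X : measurable X -> measurable (X `&` D) by move=> mX; exact: measurableI.
  have -> : Pr (A `&` D `\` A' `&` D) = (Pr (A `&` D) - Pr (A' `&` D))%E.
    by rewrite measureD ?lty//; do ?exact: mI; rewrite -setIIl (setIidr A'A).
  rewrite measureD ?lty// (setIidr A'A) AE A'E.
  by rewrite muleBl ?fin// fin_num_adde_defr// fin.
- move=> F ndF HF; have mF i : measurable (F i) by have [] := HF i.
  split; first exact: bigcup_measurable.
  rewrite setI_bigcupl.
  have cvF := nondecreasing_cvg_mu (mu := Pr) mF (bigcup_measurable (fun i _ => mF i)) ndF.
  have mFB i : measurable (F i `&` w k @^-1` B) by exact: measurableI.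
  have ndFB : {homo (fun i => F i `&` w k @^-1` B) : n m / (n <= m)%N >-> (n <= m)%O}.
    by move=> i j /ndF; rewrite !subsetEset => FF; exact: setSI.
  have cvFB := nondecreasing_cvg_mu (mu := Pr) mFB (bigcup_measurable (fun i _ => mFB i)) ndFB.
  apply: (cvg_unique _ cvFB) => //.
  rewrite (_ : Pr \o _ = fun i => (Pr (F i) * Pr (w k @^-1` B))%E).
    by apply: cvgeZr => //; exact: fin.
  by apply/funext => i /=; have [] := HF i.
Qed.

Lemma past_measurable_independent k (X : Omega -> R) : (k < T)%N ->
  measurable_fun setT (X : g_sigma_algebraType (past_cylinder k) -> R) ->
  independent2 X (w k).
Proof.
move=> kT mX A B mA mB; have := mX measurableT A mA; rewrite setTI => sX.
by have [] := past_independent kT sX mB.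
Qed.

Lemma noise_past_measurable k j : (j < k)%N ->
  measurable_fun setT (w j : g_sigma_algebraType (past_cylinder k) -> R).
Proof.
move=> jk _ B mB; rewrite setTI; apply: sub_sigma_algebra.
exists (fun i => if i == j then B else setT); split.
  by move=> i; case: ifP.
apply/seteqP; split=> [x wx i /= _|x /(_ j jk)]; last by rewrite eqxx.
by case: ifP => // /eqP ->.
Qed.
End Past.

Lemma independent2_comp (X Y : Omega -> R) (g : R -> R) :
  measurable_fun setT g -> independent2 X Y -> independent2 X (g \o Y).
Proof.
move=> mg XY A B mA mB; rewrite comp_preimage; apply: XY => //.
by rewrite -[_ @^-1` _]setTI; exact: mg.
Qed.
End Indep.

(** * Second moments of the state *)

Lemma qform_step (R : realType) n (N A C : 'M[R]_n) (r : R) x :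
  qform N (A *m x + r *: (C *m x)) =
  qform (A^T *m N *m A) x
  + qform (A^T *m N *m C + C^T *m N *m A) x * r
  + qform (C^T *m N *m C) x * r ^+ 2.
Proof.
rewrite qformD !qformM /qform; set u := A *m x; set v := C *m x.
have -> : (u + r *: v)^T = u^T + r *: v^T by apply/rowP => i; rewrite !mxE.
rewrite !(mulmxDl, mulmxDr) -!scalemxAl -!scalemxAr scalerA.
have mxD (a b : 'M[R]_1) : (a + b) 0 0 = a 0 0 + b 0 0 by rewrite mxE.
have mxZ c (a : 'M[R]_1) : (c *: a) 0 0 = c * a 0 0 by rewrite mxE.
by rewrite !(mxD, mxZ); ring.
Qed.

Section Dynamics.
Context d (Omega : measurableType d) (R : realType) (Pr : probability Omega R).
Variables (T : nat) (w : nat -> {RV Pr >-> R}).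
Hypothesis w_indep : independent_RVs [set k : nat | (k < T)%N] w.
Hypothesis w_mean : forall k : nat, (k < T)%N -> ('E_Pr[w k] = 0)%E.
Hypothesis w_var : forall k : nat, (k < T)%N ->
  ('E_Pr[(fun omega => w k omega ^+ 2)%R] = 1)%E.
Variables (n : nat) (A C : nat -> 'M[R]_n) (x0 : 'cV[R]_n).
Local Notation x := (state A C w x0).

Lemma integrable_add (f g : Omega -> R) : Pr.-integrable setT (EFin \o f) ->
  Pr.-integrable setT (EFin \o g) ->
  Pr.-integrable setT (EFin \o (fun omega => f omega + g omega)).
Proof. by move=> fi gi; exact: (integrableD measurableT fi gi). Qed.

Lemma integrable_noise_sqr k : (k < T)%N ->
  Pr.-integrable setT (EFin \o (fun omega => w k omega ^+ 2)).
Proof.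
move=> kT; apply/integrableP; split.
  by apply/measurable_EFinP; exact: measurable_funX.
have := w_var kT; rewrite unlock => wk.
under eq_integral do rewrite /= ger0_norm ?sqr_ge0//.
by rewrite wk ltry.
Qed.

(** Only the second moment is known to be finite a priori: |w| <= 1 + w^2. *)
Lemma integrable_noise k : (k < T)%N -> Pr.-integrable setT (EFin \o w k).
Proof.
move=> kT; have i1 : Pr.-integrable setT (EFin \o cst (1 : R)).
  exact: finite_measure_integrable_cst.
have := integrableD measurableT i1 (integrable_noise_sqr kT).
apply: le_integrable => // [|omega _]; first exact/measurable_EFinP.
rewrite /= lee_fin [X in _ <= X]ger0_norm; last first.
  by rewrite addr_ge0// sqr_ge0.
rewrite -real_normK ?num_real//; set a := `|_|; have a0 : 0 <= a by exact: normr_ge0.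
by have := sqr_ge0 (a - 1); nra.
Qed.

(** By [qform_step] a quadratic form in the next state is a polynomial in the
    noise whose coefficients are quadratic forms in the current state, so the
    induction runs over all [N] at once. *)
Lemma qform_state_past_measurable (N : 'M[R]_n) j k : (j <= k)%N ->
  measurable_fun setT
    ((fun omega => qform N (x j omega)) : g_sigma_algebraType (past_cylinder w k) -> R).
Proof.
elim: j N => [|j IH] N jk; first exact: (measurable_cst (qform N x0)).
under eq_fun do rewrite /= qform_step.
have mw := noise_past_measurable (w := w) jk.
apply: measurable_funD; [apply: measurable_funD|]; first exact: IH (ltnW jk).
  by apply: measurable_funM; [exact: IH (ltnW jk)|].
by apply: measurable_funM; [exact: IH (ltnW jk)|exact: measurable_funX].
Qed.

Lemma qform_state_noise (N : 'M[R]_n) (g : R -> R) k : (k < T)%N ->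
  measurable_fun setT g -> Pr.-integrable setT (EFin \o (g \o w k)) ->
  Pr.-integrable setT (EFin \o (fun omega => qform N (x k omega))) ->
  Pr.-integrable setT (EFin \o (fun omega => qform N (x k omega) * g (w k omega)))
  /\ ('E_Pr[(fun omega => qform N (x k omega) * g (w k omega))%R] =
      'E_Pr[fun omega => qform N (x k omega)] * 'E_Pr[g \o w k])%E.
Proof.
move=> kT mg ig ix; apply: expectation_mul_independent => //.
apply: independent2_comp => //; apply: (past_measurable_independent w_indep kT).
exact: qform_state_past_measurable.
Qed.

(** Each coefficient form of the one-step expansion is integrable by induction
    and independent of the current noise, which has a finite second moment. *)
Lemma integrable_qform_state (N : 'M[R]_n) k : (k <= T)%N ->
  Pr.-integrable setT (EFin \o (fun omega => qform N (x k omega))).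
Proof.
elim: k N => [|k IH] N kT.
  exact: (finite_measure_integrable_cst Pr (qform N x0)).
have ix M := IH M (ltnW kT).
have mid : measurable_fun setT (id : R -> R) by exact: measurable_id.
have msq : measurable_fun setT (fun t : R => t ^+ 2) by exact: exprn_measurable.
under eq_fun do rewrite /= qform_step.
apply: integrable_add; first apply: integrable_add.
- exact: ix.
- by have [] := qform_state_noise kT mid (integrable_noise kT)
    (ix ((A k)^T *m N *m C k + (C k)^T *m N *m A k)).
- by have [] := qform_state_noise kT msq (integrable_noise_sqr kT)
    (ix ((C k)^T *m N *m C k)).
Qed.

(** The cross term vanishes because the noise has mean 0 and is independent of
    the state; the last term keeps its weight because the noise has variance
    1. *)
Lemma expectation_qform_step (N : 'M[R]_n) k : (k < T)%N ->
  ('E_Pr[fun omega => qform N (x k.+1 omega)] =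
   'E_Pr[fun omega =>
     qform ((A k)^T *m N *m A k + (C k)^T *m N *m C k) (x k omega)])%E.
Proof.
move=> kT; have ix M := integrable_qform_state M (ltnW kT).
have mid : measurable_fun setT (id : R -> R) by exact: measurable_id.
have msq : measurable_fun setT (fun t : R => t ^+ 2) by exact: exprn_measurable.
have [i1 E1] := qform_state_noise kT mid (integrable_noise kT)
    (ix ((A k)^T *m N *m C k + (C k)^T *m N *m A k)).
have [i2 E2] := qform_state_noise kT msq (integrable_noise_sqr kT)
    (ix ((C k)^T *m N *m C k)).
under eq_fun do rewrite /= qform_step.
under [in RHS]eq_fun do rewrite qformD.
have L (f : Omega -> R) : Pr.-integrable setT (EFin \o f) -> f \in Lfun Pr 1.
  by move/Lfun1_integrable.
rewrite (expectationD (X := _ \+ _)); [|apply/L..]; last 2 first.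
- by apply: integrable_add => //; exact: ix.
- by [].
rewrite expectationD; [|by apply/L; exact: ix|exact/L].
rewrite expectationD; [|by apply/L; exact: ix..].
by rewrite E1 E2 w_mean// w_var// mule0 adde0 mule1.
Qed.

Lemma le_expectation_qform_state (M N : 'M[R]_n) k : (k <= T)%N ->
  (forall y, qform M y <= qform N y) ->
  ('E_Pr[fun omega => qform M (x k omega)] <=
   'E_Pr[fun omega => qform N (x k omega)])%E.
Proof.
move=> kT MN; rewrite unlock; apply: le_integral => //.
- exact: integrable_qform_state.
- exact: integrable_qform_state.
- by move=> omega _; rewrite lee_fin.
Qed.

Lemma expectation_qform_nonincreasing (W : nat -> 'M[R]_n) k : (k <= T)%N ->
  (forall j y, (j < T)%N ->
     qform ((A j)^T *m W j.+1 *m A j + (C j)^T *m W j.+1 *m C j) y <= qform (W j) y) ->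
  ('E_Pr[fun omega => qform (W k) (x k omega)] <= (qform (W 0%N) x0)%:E)%E.
Proof.
move=> + Wdec; elim: k => [_|k IH kT].
  by rewrite [leLHS](expectation_cst Pr (qform (W 0%N) x0)).
apply: le_trans (IH (ltnW kT)); rewrite expectation_qform_step//.
by apply: (le_expectation_qform_state (ltnW kT)) => y; exact: Wdec.
Qed.
End Dynamics.

(** * Finite-time stability *)

Theorem corollary2 (R : realType) (d : measure_display)
    (Omega : measurableType d) (Pr : probability Omega R)
    (Pr_complete : measure_is_complete Pr)
    (n : nat) (n_gt0 : (0 < n)%N) (T : nat) (T_ge1 : (1 <= T)%N)
    (w : nat -> {RV Pr >-> R})
    (w_indep : independent_RVs [set k : nat | (k < T)%N] w)
    (w_mean : forall k : nat, (k < T)%N -> ('E_Pr[w k] = 0)%E)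
    (w_cov : forall k j : nat, (k < T)%N -> (j < T)%N ->
      ('E_Pr[(fun omega => w k omega * w j omega)%R] = ((k == j)%:R)%:E)%E)
    (c1 c2 : R) (c1_gt0 : 0 < c1) (c1_le_c2 : c1 <= c2)
    (Rk : nat -> 'M[R]_n)
    (Rk_posdef : forall k : nat, (k <= T)%N -> posdefmx (Rk k))
    (A C : nat -> 'M[R]_n) :
  (exists P : nat -> 'M[R]_n,
     [/\ forall k : nat, (k <= T)%N -> posdefmx (P k),
         c1 * lambda_max (P 0%N)
           - c2 * \big[Num.min/lambda_min (P 0%N)]_(k < T.+1) lambda_min (P k)
         < 0
       & forall j : nat, (j < T)%N ->
         negdefmx
           ((A j)^T *m sqrtmx (Rk j.+1) *m P j.+1 *m sqrtmx (Rk j.+1) *m A j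
            + (C j)^T *m sqrtmx (Rk j.+1) *m P j.+1 *m sqrtmx (Rk j.+1) *m C j
            - sqrtmx (Rk j) *m P j *m sqrtmx (Rk j))]) ->
  finite_time_stable Pr (state A C w) c1 c2 T Rk.
Proof.
move=> [P [Ppos Pc Pdec]] x0 x0c k kT.
set lo := \big[_/_]_(_ < _) _ in Pc.
have w_var j : (j < T)%N -> ('E_Pr[(fun omega => w j omega ^+ 2)%R] = 1)%E.
  by move=> jT; have := w_cov _ _ jT jT; rewrite eqxx.
pose W j := sqrtmx (Rk j) *m P j *m sqrtmx (Rk j).
have Wdec j y : (j < T)%N ->
    qform ((A j)^T *m W j.+1 *m A j + (C j)^T *m W j.+1 *m C j) y <= qform (W j) y.
  move=> jT; rewrite -subr_le0 -qformN -qformD /W !mulmxA.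
  exact: negdefmx_le0 (Pdec j jT).
have VW := expectation_qform_nonincreasing w_indep w_mean w_var x0 kT Wdec.
have lo_gt0 : 0 < lo.
  apply: lt_bigmin => [|i _]; apply: lambda_min_gt0 => //; apply: Ppos => //.
  by rewrite -ltnS.
have lo_le : lo <= lambda_min (P k) by apply: (bigmin_inf (Ordinal (kT : (k < T.+1)%N))).
have W0 : qform (W 0%N) x0 <= c1 * lambda_max (P 0%N).
  have [-> Q0] := qform_weight (P 0%N) x0 (Rk_posdef 0%N isT).
  have /andP[_] := qform_lambda_bounds (sqrtmx (Rk 0%N) *m x0) (Ppos 0%N isT).1.
  move=> /le_trans; apply; rewrite -Q0 mulrC ler_wpM2r//.
  exact: lambda_max_ge0 (Ppos 0%N isT).
have RW y : qform (lo *: Rk k) y <= qform (W k) y.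
  have [-> Qk] := qform_weight (P k) y (Rk_posdef k kT).
  have /andP[+ _] := qform_lambda_bounds (sqrtmx (Rk k) *m y) (Ppos k kT).1.
  apply: le_trans; rewrite qformZ Qk ler_wpM2r//; exact: qform1_ge0.
have := le_expectation_qform_state w_indep w_var A C x0 kT RW.
move=> /le_trans/(_ VW).
(* The strict inequality must be drawn between real numbers, where the factor
   lo > 0 can be cancelled; hence the finiteness of the expectation. *)
have iR := integrable_qform_state w_indep w_var A C x0 (Rk k) kT.
have ER := integrable_fin_num measurableT iR.
under eq_fun do rewrite qformZ.
rewrite unlock; under eq_integral do rewrite EFinM.
rewrite integralZl// -(fineK ER) -EFinM lee_fin lte_fin => ERle.
rewrite -(ltr_pM2l lo_gt0) (le_lt_trans ERle)// (le_lt_trans W0)//.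
by rewrite [lo * _]mulrC -subr_lt0.
Qed.
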